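(* Let $d\ge 2$, $q\ge 2$, and let $\mathbb{P}$ be a translation-invariant probability measure on $\Omega=\{0,1,\dots,q-1\}^{\mathbb{Z}^d}$. Suppose that $\mathbb{P}$ has the finite-energy property and that the cluster-size distribution has an exponential tail with limit $\mu\in(0,1]$. Let $r\geq 1$ be an integer and let $P$ be a pattern of diameter $r$. Then there exists an $a>0$ such that $$\limsup_{n\to\infty}\big[\mathbb{P}_n(N_P\le an)\big]^{1/n}<1.$$
   Context: Setting: $S=\{0,1,\dots,q-1\}$, $\Omega=S^{\mathbb{Z}^d}$; for $V\subset\mathbb{Z}^d$, $\omega_V$ is the restriction of $\omega\in\Omega$ to $V$. Finite-energy property: there exists $h\in(0,1)$ such that for all $s\in S$, $h\le\inf_{\sigma\in\Omega}\mathbb{P}(\omega(x)=s\mid\omega_{\mathbb{Z}^d\setminus\{x\}}=\sigma_{\mathbb{Z}^d\setminus\{x\}})\le\sup_{\sigma\in\Omega}\mathbb{P}(\omega(x)=s\mid\omega_{\mathbb{Z}^d\setminus\{x\}}=\sigma_{\mathbb{Z}^d\setminus\{x\}})\le 1-h$ (by translation invariance the site $x$ is irrelevant). Clusters: a site $x$ is occupied if $\omega(x)=1$. $C(x)$ is the set of occupied sites that can be connected to $x$ by a nearest-neighbour path in $\mathbb{Z}^d$ passing only through occupied sites; $C(x)=\varnothing$ if $\omega(x)\ne 1$. $C=C(0)$, and $|X|$ is the number of sites of $X$. Exponential tail: the limit $\mu=\lim_{n\to\infty}[\mathbb{P}(|C|=n)]^{1/n}=\lim_{n\to\infty}[\mathbb{P}(n\le|C|<\infty)]^{1/n}$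 exists for some $0<\mu\le 1$ (both limits exist and are equal). Conditional measure: $\mathbb{P}_n(\cdot)=\mathbb{P}(\cdot\mid |C|=n)$. Patterns: $Q=\{x\in\mathbb{Z}^d:0\le x_i<r\ \forall i\}$, $\overline{Q}=\{x\in\mathbb{Z}^d:-1\le x_i<r+1\ \forall i\}$, $\partial Q=\overline{Q}\setminus Q$, $Q_x=x+Q$, $\partial Q_x=x+\partial Q$. A pattern of diameter $r$ is an element $P=(P(x):x\in Q)$ of $S^Q$. $P$ occurs at $x$ if $\omega(x+y)=P(y)$ for all $y\in Q$; $P$ occurs at $x$ on $C$ if moreover $\partial Q_x\subset C$. $N_P=N_P(\omega)$ is the number of sites $x$ of the grid $(r+2)\mathbb{Z}^d+(1,1,\dots,1)$ such that $P$ occurs at $x$ on $C$. *)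

(* Defs.v *)
From HB Require Import structures.
From mathcomp Require Import all_boot all_order all_algebra.
From mathcomp Require Import all_classical all_reals all_analysis.

Set Implicit Arguments.
Unset Strict Implicit.
Unset Printing Implicit Defensive.

Import Order.TTheory GRing.Theory Num.Theory.
Import numFieldNormedType.Exports.

Local Open Scope classical_set_scope.
Local Open Scope ring_scope.

(* The alphabet S = {0, ..., q - 1}.  Measurable types are built on pointed
   types, so S is written 'I_q.-1.+1; this is 'I_q as soon as 0 < q. *)
Definition spin (q : nat) : Type := 'I_q.-1.+1.

HB.instance Definition _ (q : nat) := Finite.on (spin q).
HB.instance Definition _ (q : nat) := isPointed.Build (spin q) ord0.

Definition site (d : nat) : Type := 'rV[int]_d.

HB.instance Definition _ (d : nat) := GRing.Zmodule.on (site d).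

Definition config (d q : nat) : Type := site d -> spin q.

HB.instance Definition _ (d q : nat) := Pointed.on (config d q).

(* <<s coord_events V >> is the sigma-algebra generated by the restriction map
   w |-> w_V. *)
Definition coord_events (d q : nat) (V : set (site d)) :
    set (set (config d q)) :=
  [set A | exists x s, V x /\ A = [set w : config d q | w x = s]].

(* config d q with the product sigma-algebra. *)
Definition Omega (d q : nat) : Type := g_sigma_algebraType (@coord_events d q setT).

Definition shift_config (d q : nat) (v : site d) (w : Omega d q) : Omega d q :=
  fun x => w (x + v).

Definition translation_invariant (R : realType) (d q : nat)
    (P : probability (Omega d q) R) : Prop :=
  forall (v : site d) (A : set (Omega d q)), measurable A ->
    P (shift_config v @^-1` A) = P A.

(* f is a version of the conditional probability
   sigma |-> P (w x = s | w = sigma off x), i.e. of the conditional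
   probability of {w x = s} given the sigma-algebra generated by the
   coordinates other than x. *)
Definition is_cond_prob_off (R : realType) (d q : nat)
    (P : probability (Omega d q) R) (x : site d) (s : spin q)
    (f : Omega d q -> R) : Prop :=
  let F := @coord_events d q (~` [set x]) in
  measurable_fun setT (f : g_sigma_algebraType F -> R) /\
  forall A : set (Omega d q), <<s F >> A ->
    (\int[P]_(w in A) (f w)%:E = P (A `&` [set w | w x = s]))%E.

(* Conditional probabilities being defined up to null sets only, the bounds are
   required of some version, uniformly in x and s. *)
Definition finite_energy (R : realType) (d q : nat)
    (P : probability (Omega d q) R) : Prop :=
  exists h : R, 0 < h < 1 /\
    forall (x : site d) (s : spin q), exists f : Omega d q -> R,
      [/\ is_cond_prob_off P x s f,
          (h%:E <= ereal_inf [set (f sigma)%:E | sigma in [set: Omega d q]])%E &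
          (ereal_sup [set (f sigma)%:E | sigma in [set: Omega d q]]
             <= (1 - h)%:E)%E].

Definition neighbors (d : nat) (x y : site d) : bool :=
  \sum_(i < d) `|x 0 i - y 0 i| == 1.

Definition occupied (d q : nat) (w : Omega d q) (x : site d) : bool :=
  w x == 1%N :> nat.

(* Empty when x is not occupied, since x is required to be on the path. *)
Definition site_cluster (d q : nat) (w : Omega d q) (x : site d) : set (site d) :=
  [set y | exists p : seq (site d),
    [/\ path (@neighbors d) x p, all (occupied w) (x :: p) & last x p = y]].

Definition cluster_size (R : realType) (d q : nat) (w : Omega d q) : \bar R :=
  counting (site_cluster w 0).

Definition size_eq (R : realType) (d q n : nat) : set (Omega d q) :=
  [set w | cluster_size R w = n%:R%:E].

Definition size_ge_fin (R : realType) (d q n : nat) : set (Omega d q) :=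
  [set w | (n%:R%:E <= cluster_size R w < +oo)%E].

Definition exponential_tail (R : realType) (d q : nat)
    (P : probability (Omega d q) R) (mu : R) : Prop :=
  [/\ 0 < mu <= 1,
      (fun n : nat => fine (P (size_eq R n)) `^ n%:R^-1) @ \oo --> mu &
      (fun n : nat => fine (P (size_ge_fin R n)) `^ n%:R^-1) @ \oo --> mu].

Definition cond_size (R : realType) (d q : nat)
    (P : probability (Omega d q) R) (n : nat) (A : set (Omega d q)) : R :=
  fine (P (A `&` size_eq R n)) / fine (P (size_eq R n)).

Definition cube (d r : nat) : set (site d) :=
  [set x | forall i : 'I_d, 0 <= x 0 i < r%:Z].

Definition cube_bar (d r : nat) : set (site d) :=
  [set x | forall i : 'I_d, -1 <= x 0 i < r%:Z + 1].

Definition cube_bdry (d r : nat) : set (site d) := @cube_bar d r `\` @cube d r.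

Definition pattern (d q r : nat) : Type := @cube d r -> spin q.

Definition occurs (d q r : nat) (p : pattern d q r) (w : Omega d q)
    (x : site d) : Prop :=
  forall y : @cube d r, w (x + val y) = p y.

Definition occurs_on_cluster (d q r : nat) (p : pattern d q r)
    (w : Omega d q) (x : site d) : Prop :=
  occurs p w x /\ [set x + y | y in @cube_bdry d r] `<=` site_cluster w 0.

Definition grid (d r : nat) : set (site d) :=
  [set z *+ (r + 2) + const_mx 1 | z in [set: site d]].

Definition pattern_count (R : realType) (d q r : nat) (p : pattern d q r)
    (w : Omega d q) : \bar R :=
  counting [set x | @grid d r x /\ occurs_on_cluster p w x].

(* Main.v *)
Require Import Defs.
From mathcomp Require Import all_boot all_order all_algebra.
From mathcomp Require Import finmap zify ring lra.
From mathcomp Require Import all_classical all_reals all_analysis.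
From mathcomp Require Import measurable_realfun.

Set Implicit Arguments.
Unset Strict Implicit.
Unset Printing Implicit Defensive.

Import Order.TTheory GRing.Theory Num.Theory.
Import numFieldNormedType.Exports.

Local Open Scope classical_set_scope.
Local Open Scope ring_scope.

(** The proof is a switching argument.  Tile the lattice by blocks of side
    r + 2; the pattern occurs on the cluster C of the origin at a grid point
    exactly when the corresponding block carries the pattern in its inside and
    its shell, the outermost layer of the block, lies in C.  A cluster of size n
    meets at least about n / (r + 4)^d blocks.  Choose k of the blocks it meets,
    other than the block of the origin, and operate on each: write the pattern
    in its inside, occupy its whole shell, and vacate every site next to the
    block that does not belong to C.  Since the shell is connected
    ([shell_connected]), paths of C that crossed the block are rerouted along
    it, so the rest of C stays connected; since the outside neighbours not in C
    were vacated, no other cluster is glued to C.  Hence the new cluster is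
    finite and has at least n - k (r + 4)^d sites ([surgery_cluster_size]), and
    the pattern now occurs in the k chosen blocks and nowhere else that it did
    not occur before ([surgery_occurs], [surgery_occurs_notin]).

    If the pattern occurred at most k times before, the chosen blocks form a
    k-subset of the at most 2k blocks where it occurs afterwards, so at most
    4^k choices lead to the same final configuration, whereas at least L^k
    choices are available when there are at least k L candidate blocks.
    Finite energy bounds the cost of forgetting the at most k (r + 4)^d modified
    sites by a factor h^-(k (r + 4)^d).  Comparing both ways of summing over
    pairs (configuration, choice) ([weighted_switching]) gives, for
    c = (r + 4)^d ([switching_inequality]),
      L^k P(N_P <= a n, |C| = n) <= h^-(kc) 4^k P(n - kc <= |C| < oo).

    Up to subexponential factors the last probability exceeds P(|C| = n) by at
    most mu^-(kc).  So with k proportional to n, the conditional probability is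
    of order (4 h^-c mu^-c / L)^k, which decays exponentially as soon as L is
    chosen larger than 4 h^-c mu^-c ([switching_decay]).  Fixing L first, then
    k = n / (2 c L) and a = 1 / (2 c L), concludes.

    All sums over configurations are finite: on |C| = n every event involved
    depends only on the sites of a large enough cube ([window]), so that the
    switching takes place between configurations of that cube, extended by the
    state 0 outside. *)

(** * Cylinder events and finite energy *)

Section Cylinders.
Context {d q : nat}.
Implicit Types (X Y : seq (site d)) (w t : config d q).

Definition cylinder X t : set (Omega d q) := 
  [set w : Omega d q | forall x, x \in X -> w x = t x].

Lemma cylinder_cons x X t :
  cylinder (x :: X) t = cylinder X t `&` [set w | w x = t x].
Proof.
apply/seteqP; split=> w /=.
  by move=> h; split=> [y yX|]; apply: h; rewrite inE ?eqxx// yX orbT.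
by move=> [h hx] y; rewrite inE => /predU1P[->|/h].
Qed.

Lemma cylinder_coord_events (V : set (site d)) X t :
  (forall x, x \in X -> V x) -> <<s coord_events V >> (cylinder X t).
Proof.
elim: X => [|x X IH] hV.
  have -> : cylinder [::] t = setT by apply/seteqP; split=> w.
  exact: (@measurableT _ (g_sigma_algebraType (coord_events V))).
rewrite cylinder_cons.
apply: (@measurableI _ (g_sigma_algebraType (coord_events V))).
  by apply: IH => y yX; apply: hV; rewrite inE yX orbT.
apply: sub_sigma_algebra; exists x, (t x); split=> //.
by apply: hV; rewrite inE eqxx.
Qed.

Lemma measurable_cylinder X t : measurable (cylinder X t).
Proof. exact: cylinder_coord_events. Qed.

(** There are only countably many cylinder events based on finitely many sites,
    so any union of cylinders is a countable one. *)
Lemma locally_determined_measurable (E : set (Omega d q)) :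
  (forall w, E w -> exists X, cylinder X w `<=` E) -> measurable E.
Proof.
move=> hE.
pose cyl (u : seq (site d * spin q)) : set (Omega d q) :=
  [set w | forall x s, (x, s) \in u -> w x = s].
have mcyl u : measurable (cyl u).
  elim: u => [|[x s] u IH].
    have -> : cyl [::] = setT by apply/seteqP; split.
    exact: measurableT.
  have -> : cyl ((x, s) :: u) = cyl u `&` [set w | w x = s].
    apply/seteqP; split=> w /=.
      move=> h; split=> [y a yu|]; apply: h; rewrite inE ?eqxx//.
      by rewrite yu orbT.
    move=> [h hx] y a; rewrite inE => /orP[/eqP[-> ->]//|]; exact: h.
  apply: measurableI => //.
  by apply: sub_sigma_algebra; exists x, s.
have -> : E = \bigcup_u (if asbool (cyl u `<=` E) then cyl u else set0).
  apply/seteqP; split=> [w Ew|w [u _]]; last by case: asboolP => // + ?; exact.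
  have [X hX] := hE _ Ew.
  pose u := [seq (x, w x) | x <- X].
  have cu : cyl u `<=` E.
    move=> w' hw'; apply: hX => x xX; apply: hw'.
    by apply/mapP; exists x.
  exists u => //; case: asboolP => // _ x s /mapP[y yX [-> ->]] //.
apply: countable_bigcupT_measurable; first exact: countableP.
by move=> u; case: asboolP.
Qed.

End Cylinders.

Section FiniteEnergy.
Context {R : realType} {d q : nat}.
Variable P : probability (Omega d q) R.
Implicit Types (X Y : seq (site d)) (t : config d q).

Lemma fine_probability_le (A B : set (Omega d q)) :
  measurable A -> measurable B -> A `<=` B -> fine (P A) <= fine (P B).
Proof.
move=> mA mB AB; apply: fine_le; rewrite ?fin_num_measure//.
by apply: le_measure; rewrite ?inE.
Qed.

(** Integrating the lower bound of the conditional probability over an event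
    that does not involve the site x. *)
Lemma finite_energy_site h x s f (A : set (Omega d q)) : 0 <= h ->
  is_cond_prob_off P x s f -> (forall w, h <= f w) ->
  <<s coord_events (~` [set x]) >> A ->
  h * fine (P A) <= fine (P (A `&` [set w | w x = s])).
Proof.
move=> h0 [mf hint] hf FA.
have sub : <<s coord_events (q := q) (~` [set x]) >> `<=`
   @measurable _ (Omega d q).
  by apply: sub_sigma_algebra2 => B [y [a [_ ->]]]; exists y, a.
have mA := sub _ FA.
have mAx : measurable (A `&` [set w : Omega d q | w x = s]).
  by apply: measurableI => //; apply: sub_sigma_algebra; exists x, s.
have := hint _ FA => Eint.
rewrite -lee_fin EFinM !fineK ?fin_num_measure// -Eint.
rewrite -[X in (X <= _)%E]integral_cst//.
apply: ge0_le_integral => //=.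
  apply/measurable_EFinP.
  have mf' : measurable_fun setT (f : Omega d q -> R).
    move=> _ B mB; apply: sub; exact: (mf measurableT B mB).
  exact: measurable_funS mf'.
by move=> y _; rewrite lee_fin; exact: hf.
Qed.

(** The form in which finite energy is used: prescribing the states of m
    further sites costs at most a factor h^m. *)
Definition cylinder_energy (h : R) : Prop :=
  forall X Y t, uniq X -> {in X, forall x, x \notin Y} ->
    h ^+ size X * fine (P (cylinder Y t)) <= fine (P (cylinder (X ++ Y) t)).

Lemma finite_energy_cylinder : finite_energy P ->
  exists2 h : R, 0 < h < 1 & cylinder_energy h.
Proof.
move=> [h [h01 hfe]]; exists h => // X Y t.
have /andP[h0 h1] := h01.
elim: X => [|x X IH] /=; first by rewrite expr0 mul1r.
move=> /andP[xX uX] XY.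
have [f [cf lef _]] := hfe x (t x).
have hf w : h <= f w.
  rewrite -lee_fin; apply: le_trans lef _.
  by apply: ereal_inf_lbound; exists w.
have /(IH uX) IH' : {in X, forall y, y \notin Y}.
  by move=> y yX; apply: XY; rewrite inE yX orbT.
rewrite cylinder_cons.
apply: le_trans (finite_energy_site (ltW h0) cf hf _); last first.
  apply: cylinder_coord_events => y; rewrite mem_cat => yXY /= yx.
  move: yXY; rewrite yx (negbTE xX)/=; apply/negP/XY.
  by rewrite inE eqxx.
by rewrite exprS -mulrA ler_wpM2l// ltW.
Qed.

End FiniteEnergy.

(** * Restriction to a finite window *)

Section Window.
Context {d q : nat}.
Variable V : {fset site d}.

Definition window_config := {ffun V -> spin q}.

Definition extend (s : window_config) : config d q :=
  fun x => if insub x is Some u then s u else ord0.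

Definition restrict (w : config d q) : window_config := [ffun u => w (val u)].

Lemma extendE s (u : V) : extend s (val u) = s u.
Proof. by rewrite /extend valK. Qed.

Lemma extend_out s x : x \notin V -> extend s x = ord0.
Proof. by move=> xV; rewrite /extend insubN. Qed.

Lemma extend_restrict w x : x \in V -> extend (restrict w) x = w x.
Proof.
by move=> xV; rewrite (extendE _ [` xV]%fset) ffunE.
Qed.

Lemma extend_restrict_out w x :
  (forall x, x \notin V -> w x = ord0) -> extend (restrict w) x = w x.
Proof.
move=> w0; have [xV|xV] := boolP (x \in V); first exact: extend_restrict.
by rewrite extend_out// w0.
Qed.

Lemma cylinder_window w s :
  cylinder (enum_fset V) (extend s) w <-> restrict w = s.
Proof.
split=> [h|<- x xV].
  by apply/ffunP => u; rewrite ffunE h ?extendE//; exact: valP.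
by rewrite extend_restrict.
Qed.

Context {R : realType}.
Variable P : probability (Omega d q) R.

Definition window_weight (s : window_config) : R :=
  fine (P (cylinder (enum_fset V) (extend s))).

Lemma window_weight_ge0 s : 0 <= window_weight s.
Proof. exact: fine_ge0. Qed.

Lemma window_weight_sum (B : pred window_config) :
  \sum_(s | B s) window_weight s = fine (P [set w | B (restrict w)]).
Proof.
have -> : [set w | B (restrict w)] =
    \bigcup_(s in [set s | B s]) cylinder (enum_fset V) (extend s).
  apply/seteqP; split=> [w Bw|w [s Bs]]; last by move/cylinder_window=> /= ->.
  by exists (restrict w) => //; apply/cylinder_window.
rewrite measure_fin_bigcup.
- rewrite -(@bigfs _ _ _ _ (index_enum window_config))/=.
  + by rewrite sum_fine// => s _; rewrite fin_num_measure//;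
       exact: measurable_cylinder.
  + exact: index_enum_uniq.
  + by move=> s _; rewrite mem_index_enum.
- exact: finite_finset.
- by move=> s t _ _ [w [/cylinder_window hs /cylinder_window ht]]; rewrite -hs -ht.
- by move=> s _; exact: measurable_cylinder.
Qed.

Lemma measurable_window_event (B : pred window_config) :
  measurable ([set w | B (restrict w)] : set (Omega d q)).
Proof.
apply: locally_determined_measurable => w Bw.
exists (enum_fset V) => w' hw' /=.
suff -> : restrict w' = restrict w by [].
by apply/cylinder_window => x xV; rewrite hw'// extend_restrict.
Qed.

End Window.

Arguments window_config {d} q V.

Section WindowFiber.
Context {R : realType} {d q : nat}.
Variables (P : probability (Omega d q) R) (h : R).
Hypothesis h01 : 0 < h < 1.
Hypothesis hfe : cylinder_energy P h.

(** The configurations that agree with t off X have total weight at most the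
    probability of the cylinder of t off X, and finite energy compares this with
    the weight of t alone. *)
Lemma window_fiber_weight (V : {fset site d}) (X : seq (site d)) m
    (B : pred (window_config q V)) (t : window_config q V) :
  (size X <= m)%N ->
  (forall s, B s -> forall x, x \notin X -> extend s x = extend t x) ->
  \sum_(s | B s) window_weight P s <= (h ^- m) * window_weight P t.
Proof.
move=> Xm hB; have /andP[h0 h1] := h01.
pose X' := [seq x <- undup X | x \in V]; pose Y := [seq x <- enum_fset V | x \notin X].
have uX' : uniq X' by rewrite filter_uniq// undup_uniq.
have X'Y : {in X', forall x, x \notin Y}.
  by move=> x; rewrite !mem_filter mem_undup => /andP[_ ->].
have sX' : (size X' <= m)%N.
  by rewrite (leq_trans _ Xm)// size_filter (leq_trans (count_size _ _))// size_undup.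
have -> : window_weight P t = fine (P (cylinder (X' ++ Y) (extend t))).
  congr (fine (P _)); apply/seteqP; split=> w /= wt x xV; apply: wt.
    by move: xV; rewrite mem_cat !mem_filter => /orP[|] /andP[].
  by rewrite mem_cat !mem_filter mem_undup xV; case: (x \in X).
have E : \sum_(s | B s) window_weight P s <= fine (P (cylinder Y (extend t))).
  rewrite window_weight_sum; apply: fine_probability_le.
  - exact: measurable_window_event.
  - exact: measurable_cylinder.
  move=> w Bw x /=; rewrite mem_filter => /andP[xX xV].
  by rewrite -(hB _ Bw x xX) extend_restrict.
rewrite ler_pdivlMl ?exprn_gt0//; apply: le_trans (hfe (extend t) uX' X'Y).
apply: ler_pM => //; first by rewrite exprn_ge0// ltW.
  by apply: sumr_ge0 => s _; exact: window_weight_ge0.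
by rewrite ler_wiXn2l// ltW.
Qed.

End WindowFiber.

(** * Weighted double counting *)

Lemma expn_le_bin k L : (L ^ k <= 'C(k * L, k))%N.
Proof.
elim: k => [|k IH]; first by rewrite bin0.
have [->|L0] := posnP L; first by rewrite exp0n.
have E : (L * 'C((k.+1 * L).-1, k) = 'C(k.+1 * L, k.+1))%N.
  apply/eqP; rewrite -(eqn_pmul2l (ltn0Sn k)) mulnA; apply/eqP.
  exact: mul_bin_diag.
rewrite -E expnS leq_mul2l; apply/orP; right.
by apply: leq_trans IH _; apply: leq_bin2l; rewrite mulSn; lia.
Qed.

(** Double counting of the pairs (s, S) where S is a k-subset of the set
    [sel s] of places where s may be modified into [mv s S].  From the side of s
    there are at least 'C(kL, k) >= L^k pairs; from the side of the result t the
    set S is one of the at most 2^M subsets of [occ t], and for given S the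
    preimages of t weigh at most K times t. *)
Lemma weighted_switching (R : realFieldType) (T U : finType) (p : T -> R)
    (W G : pred T) (sel occ : T -> {set U}) (mv : T -> {set U} -> T)
    (k L M : nat) (K : R) :
  (forall s, 0 <= p s) -> 0 <= K ->
  (forall s, W s -> (k * L <= #|sel s|)%N) ->
  (forall (S : {set U}) t, #|S| = k ->
     \sum_(s | [&& W s, S \subset sel s & mv s S == t]) p s <= K * p t) ->
  (forall s (S : {set U}), W s -> S \subset sel s -> #|S| = k ->
     [/\ G (mv s S), S \subset occ (mv s S) & (#|occ (mv s S)| <= M)%N]) ->
  L%:R ^+ k * \sum_(s | W s) p s <= K * 2 ^+ M * \sum_(t | G t) p t.
Proof.
move=> p0 K0 hsel hfib hmv.
pose ok (S : {set U}) t := [&& G t, S \subset occ t & (#|occ t| <= M)%N].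
have -> : K * 2 ^+ M * \sum_(t | G t) p t = \sum_(t | G t) 2 ^+ M * (K * p t).
  rewrite big_distrr; apply: eq_bigr => t _ /=; ring.
apply: le_trans (_ : \sum_(s | W s)
    \sum_(S : {set U} | (S \subset sel s) && (#|S| == k)) p s <= _).
  rewrite big_distrr; apply: ler_sum => s Ws /=.
  rewrite sumr_const
    -[#|_|](_ : #|[set S : {set U} | S \subset sel s & #|S| == k]| = _);
    last by apply: eq_card => S; rewrite !inE.
  rewrite cards_draws -[leRHS]mulr_natl ler_wpM2r// -natrX ler_nat.
  exact: leq_trans (expn_le_bin _ _) (leq_bin2l _ (hsel _ Ws)).
rewrite (exchange_big_dep (fun S : {set U} => #|S| == k)) /=; last first.
  by move=> s S _ /andP[].
apply: le_trans (_ : \sum_(S : {set U} | #|S| == k) \sum_(t | ok S t) K * p t <= _).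
  apply: ler_sum => S /eqP kS.
  rewrite (partition_big (mv ^~ S) (ok S))/=; last first.
    by move=> s /and3P[Ws Ssel _]; apply/and3P; exact: hmv.
  apply: ler_sum => t _; apply: le_trans (hfib S t kS).
  by rewrite le_eqVlt; apply/orP/or_introl/eqP/eq_bigl => s; rewrite kS eqxx andbT andbA.
rewrite (exchange_big_dep G) /=; last by move=> S t _ /and3P[].
apply: ler_sum => t Gt; rewrite sumr_const -[leLHS]mulr_natl.
apply: ler_wpM2r; first exact: mulr_ge0.
have [oM|oM] := leqP #|occ t| M; last first.
  rewrite eq_card0 => [|S]; first exact: exprn_ge0.
  by rewrite unfold_in /= /ok leqNgt oM !andbF.
rewrite -natrX ler_nat; apply: leq_trans (_ : #|powerset (occ t)| <= _)%N.
  by apply: subset_leq_card; apply/fintype.subsetP => S; rewrite inE => /andP[_ /and3P[]].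
by rewrite card_powerset leq_exp2l.
Qed.

(** * Lattice geometry and blocks *)

Section Lattice.
Context {d : nat}.
Implicit Types (x y z : site d).

Definition within1 x y := forall i, `|x 0 i - y 0 i| <= 1.

Lemma neighbors_sym x y : neighbors x y = neighbors y x.
Proof. by rewrite /neighbors; under eq_bigr do rewrite distrC. Qed.

Lemma neighbors_within1 x y : neighbors x y -> within1 x y.
Proof.
move=> /eqP xy i; rewrite -xy (bigD1 i)//= lerDl.
by apply: sumr_ge0 => j _; exact: normr_ge0.
Qed.

Lemma neighbors_unit_step x j : neighbors x (x - delta_mx 0 j).
Proof.
rewrite /neighbors (bigD1 j)//= big1 => [|i ij]; rewrite !mxE/= ?eqxx.
  by rewrite addr0 opprB addrC subrK.
by rewrite (negbTE ij) subr0 subrr.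
Qed.

Lemma path_neighbors_coord x s i :
  path (@neighbors d) x s -> `|last x s 0 i - x 0 i| <= (size s)%:Z.
Proof.
elim: s x => [|y s IH] x /=; first by rewrite subrr.
move=> /andP[/neighbors_within1/(_ i) xy /IH]; lia.
Qed.

Definition ball (N : nat) : seq (site d) :=
  [seq \row_i ((f i : nat)%:Z - N%:Z) | f : {ffun 'I_d -> 'I_(N.*2.+1)}].

Lemma mem_ball N x : reflect (forall i, `|x 0 i| <= N%:Z) (x \in ball N).
Proof.
apply: (iffP mapP) => [[f _ ->] i|hx].
  by rewrite mxE; have := ltn_ord (f i); set a := nat_of_ord _; lia.
exists [ffun i : 'I_d => inord (absz (x 0 i + N%:Z))]; first by rewrite mem_enum.
apply/rowP => i; rewrite mxE ffunE inordK; have := hx i; lia.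
Qed.

End Lattice.

Section Blocks.
Context {d : nat} (r : nat).
Implicit Types (x y z : site d).

Definition block x : site d := \row_i divz (x 0%R i) (r + 2)%N%:Z.

Lemma blockP x z :
  block x = z <-> forall i,
    z 0 i * (r + 2)%N%:Z <= x 0 i < z 0 i * (r + 2)%N%:Z + (r + 2)%N%:Z.
Proof.
split=> [<- i|hx].
  rewrite mxE; have := divz_eq (x 0 i) (r + 2)%N%:Z.
  have := @modz_ge0 (x 0 i) (r + 2)%N%:Z.
  have := @ltz_pmod (x 0 i) (r + 2)%N%:Z; lia.
apply/rowP => i; rewrite mxE; have := hx i.
have := divz_eq (x 0 i) (r + 2)%N%:Z.
have := @modz_ge0 (x 0 i) (r + 2)%N%:Z.
have := @ltz_pmod (x 0 i) (r + 2)%N%:Z.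
nia.
Qed.

(** A block splits into its inside, a cube of side r that carries the pattern,
    and a shell of thickness one around it. *)
Definition inner x :=
  [forall i, (block x 0 i * (r + 2)%N%:Z + 1 <= x 0 i) &&
             (x 0 i <= block x 0 i * (r + 2)%N%:Z + r%:Z)].

Lemma innerPn x :
  reflect (exists i, x 0 i = block x 0 i * (r + 2)%N%:Z \/
                     x 0 i = block x 0 i * (r + 2)%N%:Z + r%:Z + 1) (~~ inner x).
Proof.
have [+ _] := blockP x (block x) => /(_ erefl) hx.
rewrite negb_forall; apply: (iffP existsP) => -[i hi]; exists i; have := hx i; lia.
Qed.

(** A step that leaves a block starts from its shell. *)
Lemma inner_within1 x y : inner x -> within1 x y -> block y = block x.
Proof.
move=> /forallP hx xy; apply/blockP => i; have := hx i; have := xy i; lia.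
Qed.

(** The halo of a block is the block thickened by one site on each side; it
    contains the block and all the sites adjacent to it. *)
Definition in_halo z x := forall i,
  z 0 i * (r + 2)%N%:Z - 1 <= x 0 i <= z 0 i * (r + 2)%N%:Z + (r + 2)%N%:Z.

Lemma in_halo_block x : in_halo (block x) x.
Proof.
have [+ _] := blockP x (block x) => /(_ erefl) hx i.
have := hx i; lia.
Qed.

Lemma in_halo_within1 x y : within1 x y -> in_halo (block y) x.
Proof.
have [+ _] := blockP y (block y) => /(_ erefl) hx xy i.
have := hx i; have := xy i; lia.
Qed.

Definition halo z : seq (site d) :=
  [seq \row_i (z 0 i * (r + 2)%N%:Z - 1 + (f i : nat)%:Z)
  | f : {ffun 'I_d -> 'I_r.+4}].

Lemma mem_halo z x : reflect (in_halo z x) (x \in halo z).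
Proof.
apply: (iffP mapP) => [[f _ ->] i|hx].
  by rewrite mxE; have := ltn_ord (f i); set a := nat_of_ord _; lia.
exists [ffun i : 'I_d => inord (absz (x 0 i - z 0 i * (r + 2)%N%:Z + 1))].
  by rewrite mem_enum.
apply/rowP => i; rewrite mxE ffunE inordK; have := hx i; lia.
Qed.

Lemma size_halo z : size (halo z) = (r.+4 ^ d)%N.
Proof. by rewrite size_map -cardE card_ffun !card_ord. Qed.

Definition halos (Z : seq (site d)) := flatten [seq halo z | z <- Z].

Lemma mem_halos Z x :
  reflect (exists2 z, z \in Z & in_halo z x) (x \in halos Z).
Proof.
apply: (iffP flatten_mapP) => -[z zZ hz]; exists z => //; exact/mem_halo.
Qed.

Lemma size_halos Z : size (halos Z) = (size Z * r.+4 ^ d)%N.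
Proof.
rewrite size_flatten /shape -map_comp.
rewrite (eq_map (g := fun=> (r.+4 ^ d)%N)) => [|z]; last exact: size_halo.
by elim: Z => //= z Z ->; rewrite mulSn.
Qed.

Lemma size_le_halos D Z : uniq D ->
  (forall x, x \in D -> exists2 z, z \in Z & in_halo z x) ->
  (size D <= size Z * r.+4 ^ d)%N.
Proof.
move=> uD hD; rewrite -size_halos; apply: uniq_leq_size => // x /hD.
by move/mem_halos.
Qed.

(** Every shell site is joined to the lowest corner of its block by a path in
    the shell: as long as it is not the corner, some coordinate can be lowered
    by one without leaving the shell.  This is where d >= 2 enters: one extreme
    coordinate keeps the site in the shell while another one moves.
    The conclusion is phrased as the propagation of a property A, to be applied
    to membership in a cluster. *)
Lemma shell_connected (hd : (2 <= d)%N) z (A : site d -> Prop) :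
  (forall x y, block x = z -> block y = z -> ~~ inner x -> ~~ inner y ->
    neighbors x y -> A x -> A y) ->
  forall x y, block x = z -> block y = z -> ~~ inner x -> ~~ inner y ->
    A x -> A y.
Proof.
move=> hA.
pose corner : site d := \row_i (z 0 i * (r + 2)%N%:Z).
suff key x : block x = z -> ~~ inner x -> (A x <-> A corner).
  by move=> x y xz yz ox oy; rewrite (key x)// (key y).
have [m] := ubnP (\sum_i absz (x 0 i - z 0 i * (r + 2)%N%:Z)%R)%N.
elim: m x => // m IH x xm xz ox.
have /blockP hx := xz.
have [->//|xc] := eqVneq x corner.
have [i hi] : exists i, x 0 i != corner 0 i.
  apply/existsP; move: xc; apply: contraNT; rewrite negb_exists => /forallP h.
  by apply/eqP/rowP => i; apply/eqP; have := h i; rewrite negbK.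
(* lowering [j] preserves the shell because [k] stays extreme: take for [j]
   any non-minimal coordinate other than a given extreme one or, if there is
   none, that coordinate itself, as the others are then at their minimum *)
have [j hj oj] : exists2 j, x 0 j != corner 0 j & exists2 k, k != j &
    (x 0 k = z 0 k * (r + 2)%N%:Z \/ x 0 k = z 0 k * (r + 2)%N%:Z + r%:Z + 1).
  have /innerPn[k] := ox; rewrite xz => hk.
  have [/eqP ki|ki] := boolP (i == k); last by exists i => //; exists k => //; rewrite eq_sym.
  subst k.
  have [l li] : exists l : 'I_d, l != i.
    have /card_gt0P[l] : (0 < #|predC1 i|)%N by rewrite cardC1 card_ord; lia.
    by exists l.
  have [hl|hl] := eqVneq (x 0 l) (corner 0 l).
    by exists i => //; exists l => //; left; rewrite hl mxE.
  by exists l => //; exists i => //; rewrite eq_sym.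
pose y := x - delta_mx 0 j.
have yE k : y 0 k = x 0 k - (k == j)%:R by rewrite !mxE eqxx.
have yz : block y = z.
  apply/blockP => k; rewrite yE; have := hx k.
  have [->|] := eqVneq k j => //=; last by rewrite subr0.
  by move: hj; rewrite mxE; lia.
have oy : ~~ inner y.
  case: oj => k kj hk; apply/innerPn; exists k; rewrite yE yz (negbTE kj); lia.
have xy : neighbors x y := neighbors_unit_step x j.
have <- : A y <-> A corner.
  apply: IH => //; move: xm; rewrite ltnS; apply: leq_trans.
  rewrite (bigD1 j)//= [leqRHS](bigD1 j)//= -addSn leq_add//.
    rewrite yE eqxx; move: hj (hx j); rewrite mxE; lia.
  by apply: leq_sum => k kj; rewrite yE (negbTE kj) subr0.
split; apply: hA => //; by rewrite neighbors_sym.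
Qed.

End Blocks.

(** * Clusters and the surgery *)

Section Clusters.
Context {d q : nat}.
Implicit Types (w : Omega d q) (x y : site d).
Local Notation C w := (site_cluster w 0).

Lemma cluster_occupied w x : C w x -> occupied w x.
Proof. by move=> [s [_ /allP occ <-]]; apply: occ; rewrite mem_last. Qed.

Lemma cluster_origin w x : C w x -> C w 0.
Proof. by move=> [s [_ /= /andP[h0 _] _]]; exists [::]; split=> //=; rewrite h0. Qed.

Lemma cluster_origin_occupied w : occupied w 0 -> C w 0.
Proof. by move=> o0; exists [::]; split=> //=; rewrite o0. Qed.

Lemma cluster_step w x y : C w x -> neighbors x y -> occupied w y -> C w y.
Proof.
move=> [s [ps os <-]] xy oy; exists (rcons s y).
by rewrite rcons_path ps xy -rcons_cons all_rcons oy os last_rcons.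
Qed.

Lemma cluster_ind w (Q : site d -> Prop) :
  (C w 0 -> Q 0) ->
  (forall x y, C w x -> Q x -> neighbors x y -> C w y -> Q y) ->
  forall x, C w x -> Q x.
Proof.
move=> Q0 Qs x [s [ps os <-]].
elim/last_ind: s ps os => [|s y IH].
  by move=> _ /= /andP[h0 _]; apply/Q0/cluster_origin_occupied.
rewrite last_rcons rcons_path -rcons_cons all_rcons => /andP[ps xy] /andP[yo os].
have Cx : C w (last 0 s) by exists s.
exact: Qs Cx (IH ps os) xy (cluster_step Cx xy yo).
Qed.

Lemma cluster_path w s x : path (@neighbors d) 0 s -> all (occupied w) (0 :: s) ->
  x \in 0 :: s -> C w x.
Proof.
move=> ps os xs; case/splitPl: xs ps os => s1 s2 <-.
rewrite cat_path -cat_cons all_cat => /andP[p1 _] /andP[h1 _].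
by exists s1.
Qed.

(** A self-avoiding path inside the cluster has at most as many sites as the
    cluster, and each step changes a coordinate by at most one. *)
Lemma cluster_sub_ball w D : (forall x, C w x -> x \in D) ->
  forall x, C w x -> x \in ball (size D).
Proof.
move=> CD x [s [ps os <-]]; case/shortenP: ps os => s' ps' us' ss' os.
have os' : all (occupied w) (0 :: s').
  move: os => /= /andP[-> /allP os]; apply/allP => y /ss'; exact: os.
have : (size (0%R :: s') <= size D)%N.
  by apply: uniq_leq_size => // y ys; apply: CD; exact: cluster_path os' ys.
move=> /= /ltnW sD; apply/mem_ball => i.
have := path_neighbors_coord i ps'; rewrite mxE subr0 => /le_trans; apply.
by rewrite lez_nat.
Qed.

(** A cluster is determined by its sites and their neighbours, since exploring
    it from the origin reads no other state. *)
Lemma cluster_local w w' : w' 0 = w 0 ->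
  (forall x y, C w x -> neighbors x y -> w' y = w y) -> C w' = C w.
Proof.
move=> w0 ww; apply/seteqP; split; apply: cluster_ind.
- by move=> /cluster_occupied o; apply: cluster_origin_occupied; rewrite /occupied -w0.
- move=> x y _ Cx xy /cluster_occupied oy; apply: (cluster_step Cx xy).
  by rewrite /occupied -(ww _ _ Cx xy).
- by move=> /cluster_occupied o; apply: cluster_origin_occupied; rewrite /occupied w0.
- move=> x y Cx C'x xy /cluster_occupied oy; apply: (cluster_step C'x xy).
  by rewrite /occupied (ww _ _ Cx xy).
Qed.

End Clusters.

Section Counting.
Context {T : choiceType} {R : realType}.

Lemma counting_eqP (A : set T) n :
  counting A = n%:R%:E :> \bar R <->
  exists D : seq T, [/\ uniq D, size D = n & forall x, A x <-> x \in D].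
Proof.
rewrite /counting; split.
  case: asboolP => // fA [] /eqP; rewrite eqr_nat => /eqP nE.
  exists (fset_set A); split; [exact: fset_uniq|exact: nE|].
  by move=> x; rewrite in_fset_set// inE.
move=> [D [uD <- AD]].
have AE : A = [set` D] by apply/seteqP; split=> x /AD.
have fA : finite_set A by rewrite AE; exact: finite_seq.
case: asboolP => // _; congr (_%:R%:E).
apply/eqP; rewrite eqn_leq; apply/andP; split; apply: uniq_leq_size => //.
- by move=> x; rewrite in_fset_set// inE => /AD.
- by move=> x /AD Ax; rewrite in_fset_set// inE.
Qed.

Lemma counting_lty (A : set T) : (counting A < +oo :> \bar R)%E ->
  exists n, counting A = n%:R%:E :> \bar R.
Proof.
by rewrite /counting; case: asboolP => // fA _; exists (#|` fset_set A|%fset).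
Qed.

Lemma counting_le_size (A : set T) (D : seq T) (a : R) : uniq D ->
  {in D, forall x, A x} -> (counting A <= a%:E)%E -> (size D)%:R <= a.
Proof.
move=> uD DA cA.
have [n nE] : exists n, counting A = n%:R%:E :> \bar R.
  by apply: counting_lty; apply: le_lt_trans cA _; rewrite ltry.
move: cA; rewrite nE lee_fin; apply: le_trans.
have /counting_eqP[D' [uD' <- AD']] := nE.
by rewrite ler_nat; apply: uniq_leq_size => // x /DA /AD'.
Qed.

End Counting.

Section ClusterSize.
Context {R : realType} {d q : nat}.
Implicit Types (w : Omega d q).

Lemma size_eqP n w : size_eq R n w <->
  exists D, [/\ uniq D, size D = n & forall x, site_cluster w 0 x <-> x \in D].
Proof. exact: counting_eqP. Qed.

Lemma size_ge_finP m w : size_ge_fin R m w <->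
  exists D, [/\ uniq D, (m <= size D)%N & forall x, site_cluster w 0 x <-> x \in D].
Proof.
split=> [/andP[]|[D [uD mD CD]]].
  rewrite /cluster_size => + /counting_lty[n nE]; rewrite nE lee_fin ler_nat => mn.
  by have /counting_eqP[D [uD Dn CD]] := nE; exists D; rewrite Dn.
have /(@counting_eqP _ R) E : exists D', [/\ uniq D', size D' = size D &
    forall x, site_cluster w 0 x <-> x \in D'] by exists D.
by rewrite /size_ge_fin/= /cluster_size E lee_fin ler_nat mD ltry.
Qed.

End ClusterSize.

Section Move.
Context {d q r : nat} (hd : (2 <= d)%N) (hq : (2 <= q)%N) (p : pattern d q r).
Implicit Types (w : Omega d q) (x y z : site d).
Local Notation C w := (site_cluster w 0).

(** The configuration that the surgery writes in the chosen blocks.  The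
    translate by the grid point of the block reads the pattern; the default
    value [ord0] is never reached, inner sites being translated into the cube. *)
Definition target x : spin q :=
  if inner r x then
    if insub (x - (block r x *+ (r + 2) + const_mx 1)) is Some u then p u else ord0
  else inord 1.

Definition occurs_block w z :=
  (forall x, block r x = z -> w x = target x) /\
  (forall x, block r x = z -> ~~ inner r x -> C w x).

Lemma val_inord1 : (inord 1 : spin q) = 1%N :> nat.
Proof. by rewrite inordK//; case: q hq => [|[]]. Qed.

Lemma occupied_target x : ~~ inner r x -> occupied target x.
Proof. by move=> ix; rewrite /occupied /target (negbTE ix) val_inord1. Qed.

Lemma block_offset z y :
  block r (z *+ (r + 2) + const_mx 1 + y) = z <-> @cube_bar d r y.
Proof.
have E i : (z *+ (r + 2) + const_mx 1 + y) 0 i = z 0 i * (r + 2)%N%:Z + 1 + y 0 i.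
  by rewrite mxE [X in X + _]mxE mulmxnE -mulr_natr natz !mxE.
split=> [/blockP h i|h]; [|apply/blockP => i]; have := h i; rewrite E; lia.
Qed.

Lemma inner_offset z y : @cube_bar d r y ->
  inner r (z *+ (r + 2) + const_mx 1 + y) <-> @cube d r y.
Proof.
move=> /block_offset-/(_ z) zE; rewrite /inner zE.
have E i : (z *+ (r + 2) + const_mx 1 + y) 0 i = z 0 i * (r + 2)%N%:Z + 1 + y 0 i.
  by rewrite mxE [X in X + _]mxE mulmxnE -mulr_natr natz !mxE.
by split=> [/forallP h i|h]; [|apply/forallP => i]; have := h i; rewrite E; lia.
Qed.

(** Grid points and blocks correspond: the block z is the enlarged cube around
    the grid point (r + 2) z + (1, ..., 1). *)
Lemma occurs_on_clusterE w z :
  occurs_on_cluster p w (z *+ (r + 2) + const_mx 1) <-> occurs_block w z.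
Proof.
set x0 := _ + const_mx 1.
have bar x : block r x = z -> @cube_bar d r (x - x0).
  by move=> xz; apply/(block_offset z); rewrite -/x0 subrKC.
split=> [[occ bd]|[occ bd]].
  have shell x : block r x = z -> ~~ inner r x -> C w x.
    move=> xz ix; apply: bd; exists (x - x0); last by rewrite subrKC.
    split; first exact: bar.
    by move=> /(inner_offset z (bar _ xz)); rewrite -/x0 subrKC; exact/negP.
  split=> // x xz; have [ix|ix] := boolP (inner r x); last first.
    have /cluster_occupied/eqP wx := shell _ xz ix.
    rewrite /target (negbTE ix); apply: ord_inj; rewrite wx.
    by symmetry; exact: val_inord1.
  have xQ : @cube d r (x - x0) by apply/(inner_offset z (bar _ xz)); rewrite -/x0 subrKC.
  rewrite /target ix xz; case: insubP => [u _ uE|]; last by rewrite (mem_set xQ).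
  by rewrite -occ uE subrKC.
split=> [y|x [y [yb yQ] <-]].
  have yQ : @cube d r (val y) by have := valP y; exact: set_mem.
  have yb : @cube_bar d r (val y) by move=> i; have := yQ i; lia.
  have yz := (block_offset z (val y)).2 yb.
  rewrite (occ _ yz) /target yz (inner_offset z yb).2// addrC addKr.
  by rewrite valK.
have yz := (block_offset z y).2 yb.
by apply: bd => //; apply/negP => /(inner_offset z yb).
Qed.

Lemma pattern_countE (R : realType) w :
  pattern_count R p w = counting
    ((fun z : site d => z *+ (r + 2) + const_mx 1) @` occurs_block w).
Proof.
congr counting; apply/seteqP; split=> x.
  by move=> [[z _ <-] /occurs_on_clusterE h]; exists z.
by move=> [z /occurs_on_clusterE h <-]; split=> //; exists z.
Qed.

Lemma pattern_count_size (R : realType) (a : R) w Z :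
  uniq Z -> (forall z, z \in Z -> occurs_block w z) ->
  (pattern_count R p w <= a%:E)%E -> (size Z)%:R <= a.
Proof.
move=> uZ hZ; rewrite pattern_countE.
pose f (z : site d) := z *+ (r + 2) + const_mx 1.
rewrite -(size_map f); apply: counting_le_size.
  rewrite map_inj_uniq// => z z' /addIr zz'; apply/rowP => i.
  have /(congr1 (fun A : site d => A 0 i)) := zz'.
  by rewrite !mulmxnE -[LHS]mulr_natr -[RHS]mulr_natr natz => /mulIf; apply; lia.
by move=> x /mapP[z zZ ->]; exists z => //; exact: hZ.
Qed.

Section Surgery.
Variables (w : Omega d q) (Z : seq (site d)).
Hypothesis wC0 : C w 0.
Hypothesis Z0 : block r 0 \notin Z.
Hypothesis ZC : forall z, z \in Z -> exists2 x, C w x & block r x = z.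

(** Sites adjacent to a chosen block are vacated unless they are in the cluster:
    this prevents the occupied shells from attaching foreign clusters, which
    might be infinite, without disconnecting the cluster itself. *)
Definition surgery : Omega d q := fun x =>
  if block r x \in Z then target x
  else if `[< ~ C w x /\ exists2 y, neighbors x y & block r y \in Z >] then ord0
  else w x.
Local Notation w' := surgery.

Lemma surgery_in x : block r x \in Z -> w' x = target x.
Proof. by rewrite /surgery => ->. Qed.

Lemma surgery_cluster x : block r x \notin Z -> C w x -> w' x = w x.
Proof. by rewrite /surgery => /negbTE -> Cx; case: asboolP => // -[]. Qed.

Lemma surgery_occupied x : block r x \notin Z -> occupied w' x -> occupied w x.
Proof.
rewrite /occupied /surgery => /negbTE ->; by case: asboolP.
Qed.

Lemma surgery_occupied_near x y : block r x \notin Z -> occupied w' x ->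
  neighbors x y -> block r y \in Z -> C w x.
Proof.
move=> xZ + xy yZ; rewrite /occupied /surgery (negbTE xZ).
by case: asboolP => // + _; move=> h; apply: contrapT => nC; apply: h; split=> //; exists y.
Qed.

Lemma surgery_far x : x \notin halos r Z -> w' x = w x.
Proof.
move=> xZ; rewrite /surgery; case: ifPn => [xZ'|_].
  by case/negP: xZ; apply/mem_halos; exists (block r x) => //; exact: in_halo_block.
case: asboolP => // -[_ [y xy yZ]]; case/negP: xZ.
by apply/mem_halos; exists (block r y) => //; apply/in_halo_within1/neighbors_within1.
Qed.

(** Exploring the new cluster from the origin, a step out of a chosen block ends
    at an occupied neighbour of the block, hence at a site of the old cluster
    because the others were vacated. *)
Lemma surgery_cluster_sub x : C w' x -> block r x \notin Z -> C w x.
Proof.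
move=> C'x xZ; suff [//|xZ'] : C w x \/ block r x \in Z by rewrite xZ' in xZ.
move: x C'x {xZ}; apply: cluster_ind => [_|x y C'x IH xy C'y]; first by left.
have [yZ|yZ] := boolP (block r y \in Z); [by right|left].
have oy := cluster_occupied C'y.
have [xZ|xZ] := boolP (block r x \in Z).
  by apply: (surgery_occupied_near yZ oy _ xZ); rewrite neighbors_sym.
case: IH => [Cx|]; last by rewrite (negbTE xZ).
exact: cluster_step Cx xy (surgery_occupied yZ oy).
Qed.

Lemma block_neq_shell x y : neighbors x y -> block r x != block r y -> ~~ inner r x.
Proof.
move=> /neighbors_within1 xy; apply: contraNN => ix.
by rewrite (inner_within1 ix xy).
Qed.

Lemma shell_step z x y : z \in Z -> block r x = z -> block r y = z ->
  ~~ inner r x -> ~~ inner r y -> C w' x -> C w' y.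
Proof.
move=> zZ; apply: (shell_connected hd) => {}x {}y xz yz ix iy xy C'x.
apply: cluster_step C'x xy _.
by rewrite /occupied surgery_in ?yz//; exact: occupied_target.
Qed.

(** Follow a path of the old cluster.  Where it enters a chosen block it arrives
    in the shell, which is then entirely in the new cluster by connectedness; so
    wherever the path leaves the block again, it leaves from the new cluster. *)
Lemma surgery_cluster_sup x : C w x ->
  if block r x \in Z
  then forall y, block r y = block r x -> ~~ inner r y -> C w' y
  else C w' x.
Proof.
move: x; apply: cluster_ind => [_|x y Cx IH xy Cy].
  rewrite (negbTE Z0); apply: cluster_origin_occupied.
  by rewrite /occupied surgery_cluster//; exact: cluster_occupied wC0.
have yx : neighbors y x by rewrite neighbors_sym.
have enter : block r x != block r y -> C w' x -> C w' y.
  move=> xney C'x; apply: cluster_step C'x xy _; rewrite /occupied.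
  have [yZ|yZ] := boolP (block r y \in Z).
    rewrite surgery_in//; apply: occupied_target; apply: block_neq_shell yx _.
    by rewrite eq_sym.
  by rewrite surgery_cluster//; exact: cluster_occupied.
have [xyE|xney] := eqVneq (block r x) (block r y).
  move: IH; rewrite xyE; case: ifPn => // yZ C'x.
  apply: cluster_step C'x xy _; rewrite /occupied surgery_cluster//.
  exact: cluster_occupied.
have C'y : C w' y.
  apply: enter => //; move: IH; case: ifPn => // xZ; apply=> //.
  exact: block_neq_shell xy xney.
case: ifPn => // yZ u uy iu.
apply: (shell_step yZ) C'y => //.
by apply: block_neq_shell yx _; rewrite eq_sym.
Qed.

Lemma surgery_occurs z : z \in Z -> occurs_block w' z.
Proof.
move=> zZ; split=> x xz; first by rewrite surgery_in ?xz.
move=> ix; have [y Cy yz] := ZC zZ.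
by have := surgery_cluster_sup Cy; rewrite yz zZ => /(_ x); apply.
Qed.

(** The vacated sites of a block that was not chosen are all in its shell.
    Hence its inside is unchanged, and its shell can belong to the new cluster
    only if it belonged to the old one. *)
Lemma surgery_occurs_notin z : z \notin Z -> occurs_block w' z -> occurs_block w z.
Proof.
move=> zZ [occ shell].
have shell' x : block r x = z -> ~~ inner r x -> C w x.
  by move=> xz ix; apply: surgery_cluster_sub; [exact: shell|rewrite xz].
split=> // x xz; rewrite -occ//; have [ix|ix] := boolP (inner r x); last first.
  by rewrite surgery_cluster ?xz//; exact: shell'.
rewrite /surgery xz (negbTE zZ); case: asboolP => // -[_ [y xy]].
by rewrite (inner_within1 ix) ?xz ?(negbTE zZ)//; exact: neighbors_within1.
Qed.

(** Only cluster sites inside the chosen blocks can be lost, and only sites of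
    these blocks can be gained. *)
Lemma surgery_cluster_size D : uniq D -> (forall x, C w x <-> x \in D) ->
  exists D', [/\ uniq D', (size D - size Z * r.+4 ^ d <= size D')%N,
    forall x, C w' x <-> x \in D' & {subset D' <= D ++ halos r Z}].
Proof.
move=> uD CD.
pose D' := undup [seq x <- D ++ halos r Z | `[< C w' x >]].
exists D'; split.
- exact: undup_uniq.
- rewrite leq_subLR addnC.
  rewrite -(count_predC [pred x | block r x \in Z] D) addnC -!size_filter leq_add//.
    apply: uniq_leq_size; first exact: filter_uniq.
    move=> x; rewrite mem_filter /= => /andP[xZ /CD Cx].
    rewrite mem_undup mem_filter mem_cat (CD x).1// andbT; apply/asboolP.
    by have := surgery_cluster_sup Cx; rewrite (negbTE xZ).
  apply: size_le_halos; first exact: filter_uniq.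
  move=> x; rewrite mem_filter /= => /andP[xZ _].
  by exists (block r x) => //; exact: in_halo_block.
- move=> x; rewrite mem_undup mem_filter; split=> [C'x|/andP[/asboolP]//].
  apply/andP; split; first exact/asboolP.
  rewrite mem_cat; have [xZ|xZ] := boolP (block r x \in Z).
    by apply/orP; right; apply/mem_halos; exists (block r x) => //; exact: in_halo_block.
  by rewrite (CD x).1//; exact: surgery_cluster_sub.
- by move=> x; rewrite mem_undup mem_filter => /andP[].
Qed.

End Surgery.

End Move.

(** * Locality of the cluster events *)

Section Locality.
Context {d q r : nat} (n : nat).
Implicit Types w : Omega d q.
Local Notation C w := (site_cluster w 0).

(** The halos of the blocks that meet a cluster of size n reach distance
    n + r + 2; one more layer contains all the neighbours of these sites. *)
Definition window : {fset site d} := [fset x in @ball d (n + r + 3)]%fset.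

Lemma mem_window x : (x \in window) = (x \in ball (n + r + 3)).
Proof. by rewrite inE. Qed.

Lemma window_origin : 0 \in window.
Proof. by rewrite mem_window; apply/mem_ball => i; rewrite mxE. Qed.

Lemma halo_sub_ball (x y : site d) : x \in ball n ->
  in_halo r (block r x) y -> y \in ball (n + r + 2).
Proof.
move=> /mem_ball hx hy; apply/mem_ball => i; have := hx i; have := hy i.
have [+ _] := blockP r x (block r x) => /(_ erefl i); lia.
Qed.

Lemma ball_neighbor m (x y : site d) :
  x \in ball m -> neighbors x y -> y \in @ball d m.+1.
Proof.
move=> /mem_ball hx /neighbors_within1 xy; apply/mem_ball => i.
have := hx i; have := xy i; lia.
Qed.

Lemma block_ball m (x : site d) : x \in ball m -> block r x \in @ball d m.
Proof.
move=> /mem_ball hx; apply/mem_ball => i; have := hx i.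
have [+ _] := blockP r x (block r x) => /(_ erefl i); nia.
Qed.

Lemma ball_sub m m' : (m <= m')%N -> {subset @ball d m <= ball m'}.
Proof. by move=> mm x /mem_ball hx; apply/mem_ball => i; have := hx i; lia. Qed.

Lemma cluster_restrict w : (forall x, C w x -> x \in ball (n + r + 2)) ->
  C (extend (restrict window w)) = C w.
Proof.
move=> Cn; apply: cluster_local; first by rewrite extend_restrict ?window_origin.
move=> x y /Cn xn xy; rewrite extend_restrict// mem_window.
by have := ball_neighbor xn xy; apply: ball_sub; lia.
Qed.

Lemma cluster_extend (s : window_config q window) w :
  (forall x, C (extend s) x -> x \in ball (n + r + 2)) -> restrict window w = s ->
  C w = C (extend s).
Proof.
move=> Cn ws; apply: cluster_local; first by rewrite -ws extend_restrict ?window_origin.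
move=> x y /Cn xn xy; rewrite -ws extend_restrict// mem_window.
by have := ball_neighbor xn xy; apply: ball_sub; lia.
Qed.

Lemma exists_shell_site (z : site d) : (0 < d)%N ->
  exists2 x : site d, block r x = z & ~~ inner r x.
Proof.
move=> d0; exists (\row_i (z 0 i * (r + 2)%N%:Z)).
  by apply/blockP => i; rewrite mxE; lia.
have zE : block r (\row_i (z 0 i * (r + 2)%N%:Z)) = z.
  by apply/blockP => i; rewrite mxE; lia.
apply/innerPn; by exists (Ordinal d0); left; rewrite zE mxE.
Qed.

(** The shell of a block where the pattern occurs is nonempty and lies in the
    cluster, so the whole block is within the window. *)
Lemma occurs_block_local (p : pattern d q r) w w' z : (0 < d)%N ->
  (forall x, C w x -> x \in ball n) ->
  C w' = C w -> {in window, w =1 w'} -> occurs_block p w z -> occurs_block p w' z.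
Proof.
move=> d0 Cn C' ww [occ shell]; split=> x xz; last by rewrite C'; exact: shell.
have [y yz iy] := exists_shell_site z d0.
rewrite -ww ?occ// mem_window.
have yn : y \in ball n by apply/Cn/shell.
have := halo_sub_ball yn (y := x); rewrite yz -xz => /(_ (in_halo_block r x)).
by apply: ball_sub; lia.
Qed.

End Locality.

(** * The switching inequality *)

Section Switching.
Context {R : realType} {d q r : nat} (hd : (2 <= d)%N) (hq : (2 <= q)%N).
Variables (p : pattern d q r) (P : probability (Omega d q) R) (h : R).
Hypothesis h01 : 0 < h < 1.
Hypothesis hfe : cylinder_energy P h.
Variables (n k L : nat) (a : R).
Local Notation c := (r.+4 ^ d)%N.
Hypothesis nL : ((k * L).+1 * c <= n)%N.
Hypothesis ak : a < k.+1%:R.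
Local Notation C w := (site_cluster w 0).
Local Notation V := (window (d := d) (r := r) n).
Local Notation rare := [set w : Omega d q | (pattern_count R p w <= a%:E)%E].

Lemma measurable_size_ge_fin m : measurable (size_ge_fin R m : set (Omega d q)).
Proof.
apply: locally_determined_measurable => w /size_ge_finP[D [uD mD CD]].
exists (0 :: ball (size D).+1) => v vw; apply/size_ge_finP; exists D; split=> // x.
rewrite -CD (cluster_local (w := w) (w' := v))//.
  by apply: vw; rewrite mem_head.
move=> y z Cy yz; apply: vw; rewrite inE; apply/orP; right.
apply: ball_neighbor yz; apply: cluster_sub_ball Cy => u; exact: (CD u).1.
Qed.

Lemma size_eq_ball (w : Omega d q) m : size_eq R m w ->
  forall x, C w x -> x \in ball m.
Proof.
move=> /size_eqP[D [_ <- CD]]; apply: cluster_sub_ball => x; exact: (CD x).1.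
Qed.

(** A cluster of size n and the blocks that it meets are read off the window.
    In particular the event is a finite union of cylinders, hence measurable. *)
Lemma rare_size_window :
  rare `&` size_eq R n = [set w | (rare `&` size_eq R n) (extend (restrict V w))].
Proof.
have loc w w' : C w' = C w -> {in V, w =1 w'} -> (rare `&` size_eq R n) w ->
    (rare `&` size_eq R n) w'.
  move=> C' ww [rw sw]; split; last by rewrite /size_eq /cluster_size/= C'.
  have Cn := size_eq_ball sw.
  suff E : occurs_block p w' = occurs_block p w.
    by move: rw => /=; rewrite !pattern_countE// E.
  apply/seteqP; split=> z; last exact: (occurs_block_local (ltnW hd) Cn C' ww).
  have Cn' x : C w' x -> x \in ball n by rewrite C'; exact: Cn.
  by apply: (occurs_block_local (ltnW hd) Cn') => // x xV; rewrite ww.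
apply/seteqP; split=> w hw; apply: loc (hw).
- apply: cluster_restrict => x Cx; have := size_eq_ball hw.2 Cx.
  by apply: ball_sub; lia.
- by move=> x xV; rewrite extend_restrict.
- apply: cluster_extend erefl => x Cx; have := size_eq_ball hw.2 Cx.
  by apply: ball_sub; lia.
- by move=> x xV; rewrite extend_restrict.
Qed.

Definition candidates (s : window_config q V) : {set V} :=
  [set u | (val u != block r 0) &&
           `[< exists2 x, C (extend s) x & block r x = val u >]].

Definition occurrences (s : window_config q V) : {set V} :=
  [set u | `[< occurs_block p (extend s) (val u) >]].

Definition sites_of (S : {set V}) : seq (site d) := [seq val u | u <- enum S].

Definition window_surgery (s : window_config q V) (S : {set V}) :
    window_config q V :=
  restrict V (surgery p (extend s) (sites_of S)).

Lemma uniq_sites_of S : uniq (sites_of S).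
Proof. by rewrite map_inj_uniq ?enum_uniq//; exact: val_inj. Qed.

Lemma size_sites_of S : size (sites_of S) = #|S|.
Proof. by rewrite size_map cardE. Qed.

Lemma mem_sites_of S (u : V) : (val u \in sites_of S) = (u \in S).
Proof. by rewrite mem_map ?mem_enum//; exact: val_inj. Qed.

(** Each block contains at most c sites of the cluster, so at least k L + 1
    blocks meet it, and the block of the origin is one of them at most. *)
Lemma candidates_many s : size_eq R n (extend s) -> (k * L <= #|candidates s|)%N.
Proof.
move=> sn; have Cn := size_eq_ball sn; have /size_eqP[D [uD Dn CD]] := sn.
have : (size D <= (#|candidates s|).+1 * c)%N.
  rewrite -size_sites_of -[_.+1]/(size (block r 0 :: sites_of (candidates s))).
  apply: size_le_halos => // x xD; exists (block r x); last exact: in_halo_block.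
  rewrite inE; have [//|x0] := eqVneq (block r x) (block r 0).
  have Cx := (CD x).2 xD.
  have xV : block r x \in V.
    rewrite mem_window; apply: (@ball_sub _ n); first lia.
    by apply: block_ball; exact: Cn.
  have /= -> := mem_sites_of (candidates s) [` xV]%fset.
  by rewrite inE x0; apply/asboolP; exists x.
rewrite Dn => /(leq_trans nL); rewrite leq_pmul2r ?expn_gt0//.
Qed.

Section Admissible.
Variables (s : window_config q V) (S : {set V}).
Hypothesis sn : size_eq R n (extend s).
Hypothesis Ss : S \subset candidates s.

Lemma admissible_origin : (0 < n)%N -> C (extend s) 0.
Proof.
move=> n0; have /size_eqP[D [uD Dn CD]] := sn.
case: D Dn CD uD => [|x D] Dn CD _; first by exfalso; move: n0; rewrite -Dn.
by have := (CD x).2 (mem_head _ _); exact: cluster_origin.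
Qed.

Lemma admissible_blocks z : z \in sites_of S ->
  z != block r 0 /\ exists2 x, C (extend s) x & block r x = z.
Proof.
move=> /mapP[u]; rewrite mem_enum => /(fintype.subsetP Ss); rewrite inE.
by move=> /andP[u0 /asboolP hu] ->.
Qed.

Lemma admissible_origin_notin : block r 0 \notin sites_of S.
Proof. by apply/negP => /admissible_blocks[]; rewrite eqxx. Qed.

Lemma halos_sub_ball x : x \in halos r (sites_of S) -> x \in ball (n + r + 2).
Proof.
move=> /mem_halos[z /admissible_blocks[_ [y Cy <-]]].
by apply: halo_sub_ball; exact: size_eq_ball sn _ Cy.
Qed.

Lemma extend_window_surgery :
  extend (window_surgery s S) = surgery p (extend s) (sites_of S).
Proof.
apply/funext => x; apply: extend_restrict_out => {}x xV.
have xZ : x \notin halos r (sites_of S).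
  apply: contra xV => /halos_sub_ball; rewrite mem_window; apply: ball_sub; lia.
by rewrite surgery_far// extend_out.
Qed.

End Admissible.

(** The clause on the ball makes the cluster of every configuration that
    extends s equal to the cluster of s, so that the size bound carries over. *)
Definition big_confined (s : window_config q V) : bool :=
  `[< size_ge_fin R (n - k * c) (extend s) /\
      forall x, C (extend s) x -> x \in ball (n + r + 2) >].

Lemma switching_inequality :
  L%:R ^+ k * fine (P (rare `&` size_eq R n)) <=
    (h ^- (k * c)) * 2 ^+ (k + k) * fine (P (size_ge_fin R (n - k * c))).
Proof.
have n0 : (0 < n)%N by apply: leq_trans nL; rewrite muln_gt0 expn_gt0.
have /andP[h0 _] := h01.
pose W (s : window_config q V) := `[< (rare `&` size_eq R n) (extend s) >].
have -> : rare `&` size_eq R n = [set w | W (restrict V w)].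
  by rewrite rare_size_window; apply/seteqP; split=> w /asboolP.
rewrite -window_weight_sum.
have K0 : 0 <= h ^- (k * c) by rewrite invr_ge0 exprn_ge0// ltW.
apply: le_trans (_ : h ^- (k * c) * 2 ^+ (k + k) *
    \sum_(t | big_confined t) window_weight P t <= _); last first.
  apply: ler_wpM2l; first by rewrite mulr_ge0// exprn_ge0.
  rewrite window_weight_sum; apply: fine_probability_le.
  - exact: measurable_window_event.
  - exact: measurable_size_ge_fin.
  move=> w /asboolP[+ bw]; rewrite /size_ge_fin /cluster_size/=.
  by rewrite -(cluster_extend bw erefl).
apply: (@weighted_switching _ _ V _ W big_confined
  candidates occurrences window_surgery) => //.
- exact: window_weight_ge0.
- by move=> s /asboolP[_]; exact: candidates_many.
- move=> S t Sk; apply: (window_fiber_weight h01 hfe (X := halos r (sites_of S))).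
    by rewrite size_halos size_sites_of Sk.
  move=> s /and3P[/asboolP[_ sn] Ss /eqP <-] x xZ.
  by rewrite extend_window_surgery// surgery_far.
- move=> s S /asboolP[rs sn] Ss Sk.
  have E := extend_window_surgery sn Ss.
  have C0 := admissible_origin sn n0.
  have b0 := admissible_origin_notin Ss.
  have bZ z (zS : z \in sites_of S) := (admissible_blocks Ss zS).2.
  have /size_eqP[D [uD Dn CD]] := sn.
  have [D' [uD' D'n CD' D'sub]] := surgery_cluster_size hd hq p C0 b0 uD CD.
  split.
  + apply/asboolP; rewrite E; split.
      by apply/size_ge_finP; exists D'; split=> //; move: D'n; rewrite Dn size_sites_of Sk.
    move=> x /CD' /D'sub; rewrite mem_cat => /orP[/CD|]; last exact: (halos_sub_ball sn Ss).
    by move=> /(size_eq_ball sn); apply: ball_sub; lia.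
  + apply/fintype.subsetP => u uS; rewrite inE; apply/asboolP; rewrite E.
    by apply: surgery_occurs; rewrite ?mem_sites_of.
  + rewrite -(cardsID S) leq_add//.
      by rewrite -Sk subset_leq_card// subsetIr.
    rewrite -size_sites_of -ltnS -(ltr_nat R); apply: le_lt_trans ak.
    apply: pattern_count_size rs => //; first exact: uniq_sites_of.
    move=> z /mapP[u]; rewrite mem_enum !inE => /andP[uS /asboolP +] ->.
    rewrite E; apply: surgery_occurs_notin; rewrite ?mem_sites_of//.
Qed.

End Switching.

(** * From the switching inequality to exponential decay *)

Section Roots.
Context {R : realType}.
Implicit Types (x b : R) (n : nat).

Lemma powR_inv_exprn x n : (0 < n)%N -> 0 <= x -> (x `^ n%:R^-1) ^+ n = x.
Proof.
move=> n0 x0; rewrite -powR_mulrn ?powR_ge0// -powRrM mulVf ?powRr1//.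
by rewrite pnatr_eq0 -lt0n.
Qed.

Lemma powR_inv_le x b n : (0 < n)%N -> 0 <= x -> 0 <= b -> x <= b ^+ n ->
  x `^ n%:R^-1 <= b.
Proof.
move=> n0 x0 b0 xb; rewrite -(@ler_pXn2r _ n)// ?nnegrE ?powR_ge0//.
by rewrite powR_inv_exprn.
Qed.

Lemma exists_root_gt1 x n : (0 < n)%N -> 1 < x -> exists2 y, 1 < y & y ^+ n = x.
Proof.
move=> n0 x1; have x0 : 0 <= x by rewrite ltW// (lt_trans ltr01).
exists (x `^ n%:R^-1); last exact: powR_inv_exprn.
rewrite ltNge; apply/negP => y1.
by have := exprn_ile1 n (powR_ge0 _ _) y1; rewrite powR_inv_exprn// leNgt x1.
Qed.

(** The existence of the limit of the n-th roots amounts to exponential bounds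
    with any rate slightly off the limit. *)
Lemma root_cvg_bounds (u : nat -> R) (mu rho : R) : (forall n, 0 <= u n) ->
  0 < mu -> 1 < rho -> (fun n => u n `^ n%:R^-1) @ \oo --> mu ->
  \forall n \near \oo, (mu / rho) ^+ n <= u n <= (rho * mu) ^+ n.
Proof.
move=> u0 mu0 rho1 umu.
have rho0 : 0 < rho by apply: lt_trans rho1.
have lo : mu / rho < mu by rewrite ltr_pdivrMr// ltr_pMr.
have hi : mu < rho * mu by rewrite ltr_pMl.
near=> n.
have n0 : (0 < n)%N by near: n; exact: nbhs_infty_gt.
rewrite -[u n](powR_inv_exprn n0)//; apply/andP; split.
  rewrite lerXn2r ?nnegrE ?powR_ge0 ?divr_ge0 ?ltW//.
  by near: n; exact: (cvgr_gt _ umu).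
rewrite lerXn2r ?nnegrE ?powR_ge0 ?mulr_ge0 ?ltW//.
by near: n; exact: (cvgr_lt _ umu).
Unshelve. all: by end_near. Qed.

Lemma limn_esup_le_near (u : nat -> \bar R) (b : \bar R) :
  (\forall n \near \oo, u n <= b)%E -> (limn_esup u <= b)%E.
Proof.
move=> ub; rewrite /limn_esup limf_esupE; apply: ereal_inf_le.
exists (ereal_sup (u @` [set n | (u n <= b)%E])).
  by exists [set n | (u n <= b)%E].
by apply: ge_ereal_sup => _ [n un <-].
Qed.

End Roots.

Lemma divn_double_gt n M : (0 < M <= n)%N -> (n <= n %/ M * (2 * M))%N.
Proof.
move=> /andP[M0 Mn]; have := ltn_ceil n M0; have : (0 < n %/ M)%N by rewrite divn_gt0.
by move: (n %/ M)%N => k; nia.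
Qed.

Lemma leq_half_sub n m j : (2 * m <= n)%N -> (2 * j <= n)%N -> (m <= n - j)%N.
Proof. lia. Qed.

Section Decay.
Context {R : realType}.
Variables (mu h : R) (c : nat) (v t : nat -> R).
Hypothesis mu01 : 0 < mu <= 1.
Hypothesis h0 : 0 < h.
Hypothesis c0 : (0 < c)%N.
Hypothesis v0 : forall n, 0 <= v n.
Hypothesis t0 : forall n, 0 <= t n.
Hypothesis vmu : (fun n => v n `^ n%:R^-1) @ \oo --> mu.
Hypothesis tmu : (fun n => t n `^ n%:R^-1) @ \oo --> mu.

(** The constant L beats K = 4 h^-c mu^-c by a factor 2, so the main factor
    (K / L)^k is at most (1/2)^k.  The error rho^(2n) made by replacing the two
    probabilities by powers of mu is at most (3/2)^k by the choice of rho, since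
    n <= 2 M k.  What is left is (3/4)^k <= g^-n. *)
Lemma switching_decay : exists2 L : nat, (0 < L)%N &
  forall u : nat -> R, (forall n, 0 <= u n) ->
    (forall n k, k = (n %/ (2 * c * L))%N -> (0 < k)%N ->
      L%:R ^+ k * u n <= h ^- (k * c) * 2 ^+ (k + k) * t (n - k * c)) ->
  (limn_esup (fun n => ((u n / v n) `^ n%:R^-1)%:E) < 1)%E.
Proof.
have /andP[mu0 mu1] := mu01.
pose K : R := h ^- c * 2 ^+ 2 * mu ^- c.
have K0 : 0 < K by rewrite !mulr_gt0 ?invr_gt0 ?exprn_gt0.
have [L L0 KL] : exists2 L : nat, (0 < L)%N & 2 * K <= L%:R.
  exists (Num.truncn (2 * K)).+1 => //; apply/ltW/truncnS_gt.
exists L => // u u0 hu.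
pose M := (2 * c * L)%N.
have M0 : (0 < M)%N by rewrite !muln_gt0 c0 L0.
have [rho rho1 rhoM] : exists2 rho : R, 1 < rho & rho ^+ (4 * M) = 3 / 2.
  by apply: exists_root_gt1; [rewrite muln_gt0 M0|lra].
have [g g1 gM] : exists2 g : R, 1 < g & g ^+ (2 * M) = 4 / 3.
  by apply: exists_root_gt1; [rewrite muln_gt0 M0|lra].
have rho0 : 0 < rho by apply: lt_trans rho1.
have g0 : 0 < g by apply: lt_trans g1.
apply: (@le_lt_trans _ _ (g^-1)%:E); last by rewrite lte_fin invf_lt1.
apply: limn_esup_le_near.
have [n1 _ hv] := root_cvg_bounds v0 mu0 rho1 vmu.
have [n2 _ ht] := root_cvg_bounds t0 mu0 rho1 tmu.
near=> n.
have nM : (M <= n)%N by near: n; exact: nbhs_infty_ge.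
have nn1 : (n1 <= n)%N by near: n; exact: nbhs_infty_ge.
have nn2 : (2 * n2 <= n)%N by near: n; exact: nbhs_infty_ge.
have n0 : (0 < n)%N := leq_trans M0 nM.
pose k := (n %/ M)%N.
have k0 : (0 < k)%N by rewrite divn_gt0.
have kM : (k * M <= n)%N := leq_divM n M.
have nk : (n <= k * (2 * M))%N by apply: divn_double_gt; rewrite M0.
have kc : (2 * (k * c) <= n)%N.
  apply: leq_trans kM; rewrite mulnCA leq_pmul2l// /M -[leqLHS]muln1.
  by rewrite leq_pmul2l// muln_gt0.
have kcn : (k * c <= n)%N by rewrite (leq_trans _ kc)// leq_pmull.
have /andP[vlo _] := hv _ nn1.
have jn2 : (n2 <= n - k * c)%N := leq_half_sub nn2 kc.
have /andP[_ thi] := ht _ jn2.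
have vn0 : 0 < v n by apply: lt_le_trans vlo; rewrite exprn_gt0// divr_gt0.
rewrite lee_fin; apply: powR_inv_le => //.
- by rewrite divr_ge0.
- by rewrite invr_ge0 ltW.
rewrite ler_pdivrMr//.
have Lk : (0 : R) < L%:R ^+ k by rewrite exprn_gt0// ltr0n.
rewrite -(ler_pM2l Lk); apply: le_trans (hu n k erefl k0) _.
apply: le_trans (_ : h ^- (k * c) * 2 ^+ (k + k) * (rho * mu) ^+ (n - k * c) <= _).
  by rewrite ler_wpM2l// mulr_ge0// ?invr_ge0 exprn_ge0// ltW.
apply: le_trans (_ : L%:R ^+ k * (g^-1 ^+ n * (mu / rho) ^+ n) <= _); last first.
  by rewrite ler_pM2l// ler_pM2l// exprn_gt0// invr_gt0.
(* dividing by mu^n leaves mu^-c for each switched block *)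
have muE : (rho * mu) ^+ (n - k * c) = rho ^+ (n - k * c) * (mu ^+ n * (mu ^- c) ^+ k).
  rewrite exprMn; congr (_ * _).
  rewrite -{2}(subnK kcn).
  rewrite exprD exprVn -exprM mulnC -mulrA divff ?mulr1//.
  by rewrite expf_neq0// gt_eqF.
have hE : h ^- (k * c) = (h ^- c) ^+ k by rewrite mulnC exprM exprVn.
have -> : h ^- (k * c) * 2 ^+ (k + k) * (rho * mu) ^+ (n - k * c) =
    (K ^+ k * rho ^+ (n - k * c)) * mu ^+ n.
  by rewrite muE hE addnn -mul2n exprM /K !exprMn; ring.
have -> : L%:R ^+ k * (g^-1 ^+ n * (mu / rho) ^+ n) =
    (L%:R ^+ k * (g^-1 ^+ n * rho^-1 ^+ n)) * mu ^+ n.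
  by rewrite exprMn; ring.
rewrite ler_pM2r ?exprn_gt0//.
rewrite !exprVn -invfM ler_pdivlMr ?mulr_gt0 ?exprn_gt0//.
apply: le_trans (_ : (K ^+ k * rho ^+ n) * ((4 / 3) ^+ k * rho ^+ n) <= _).
  apply: ler_pM.
  - by rewrite mulr_ge0 ?exprn_ge0 ?ltW.
  - by rewrite mulr_ge0 ?exprn_ge0 ?ltW.
  - by rewrite ler_pM2l ?exprn_gt0// ler_weXn2l ?leq_subr// ltW.
  - rewrite ler_pM2r ?exprn_gt0// -gM -exprM ler_weXn2l ?ltW//.
    by rewrite mulnC.
have rhon : rho ^+ n * rho ^+ n <= (3 / 2) ^+ k.
  rewrite -rhoM -exprD -exprM ler_weXn2l ?(ltW rho1)//.
  have -> : (4 * M * k = k * (2 * M) + k * (2 * M))%N by ring.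
  exact: leq_add.
apply: le_trans (_ : K ^+ k * (4 / 3) ^+ k * (3 / 2) ^+ k <= _).
  rewrite mulrACA ler_pM2l// mulr_gt0 ?exprn_gt0//; lra.
have K1 : 0 <= K * (4 / 3) * (3 / 2) by lra.
by rewrite -!exprMn lerXn2r ?nnegrE ?ler0n//; lra.
Unshelve. all: by end_near. Qed.

End Decay.

Theorem theorem1p7 (R : realType) (d q : nat) (hd : (2 <= d)%N)
    (hq : (2 <= q)%N) (P : probability (Omega d q) R) (mu : R)
    (hinv : translation_invariant P) (hfe : finite_energy P)
    (htail : exponential_tail P mu)
    (r : nat) (hr : (1 <= r)%N) (p : pattern d q r) :
  exists a : R, 0 < a /\
    (limn_esup (fun n : nat =>
       (cond_size P n [set w | (pattern_count R p w <= (a * n%:R)%:E)%E]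
          `^ n%:R^-1)%:E) < 1)%E.
Proof.
have [h h01 hcyl] := finite_energy_cylinder hfe.
have /andP[h0 _] := h01; have [mu01 vmu tmu] := htail.
pose c := (r.+4 ^ d)%N; have c0 : (0 < c)%N by rewrite expn_gt0.
have pr0 (A : set (Omega d q)) : 0 <= fine (P A) by exact: fine_ge0.
have [L L0 decay] := switching_decay mu01 h0 c0 (fun=> pr0 _) (fun=> pr0 _) vmu tmu.
pose M := (2 * c * L)%N; have M0 : (0 < M)%N by rewrite !muln_gt0 c0 L0.
exists (M%:R^-1); split; first by rewrite invr_gt0 ltr0n.
apply: decay => [n|n k kE k0]; first exact: pr0.
apply: switching_inequality => //.
- have kM : (k * M <= n)%N by rewrite kE leq_divM.
  apply: leq_trans kM; rewrite /M.
  have -> : (k * (2 * c * L) = (k * L + k * L) * c)%N by ring.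
  by rewrite leq_pmul2r// -addn1 leq_add2l muln_gt0 k0.
- rewrite mulrC ltr_pdivrMr ?ltr0n// -natrM ltr_nat.
  by rewrite kE ltn_ceil.
Qed.
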